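(* Let $(M=G/H,ds^2)$ be a connected pseudo-Riemannian $G$-geodesic orbit nilmanifold of metric index three, where $G=N\rtimes H$ with $N$ nilpotent. Let $\langle\cdot,\cdot\rangle$ denote the inner product on $\mathfrak n=\mathrm{Lie}(N)$ induced by $ds^2$, and let $\mathfrak d=[\mathfrak n,\mathfrak n]$. If the restriction of $\langle\cdot,\cdot\rangle$ to $\mathfrak d$ is degenerate, then there is a nonzero $\mathfrak h$-invariant subspace $F\subset\operatorname{rad}\mathfrak d=\mathfrak d\cap\mathfrak d^\perp$ satisfying $[F,F^\perp]=0$. Consequently $(\mathfrak n,\langle\cdot,\cdot\rangle)$ is a $2\dim F$-dimensional double extension of a metric Lie algebra of strictly smaller index (namely $F^\perp/F$) corresponding to a GO nilmanifold.
   Context: Setting: $N$ is a connected nilpotent Lie group with (real, finite-dimensional) Lie algebra $\mathfrak n$, equipped with a left-invariant pseudo-Riemannian metric $ds^2$ given by a nondegenerate symmetric bilinear form (''inner product'') $\langle\cdot,\cdot\rangle$ on $\mathfrak n$; $H$ is a connected Lie group of automorphisms of $N$ preserving $ds^2$; $G=N\rtimes H$ acts on $M=G/H\cong N$ by isometries. Thus $\mathfrak g=\mathfrak h\oplus\mathfrak n$ is a reductive decomposition, and $\mathfrak h=\mathrm{Lie}(H)$ is identified with a Lie algebra of derivations of $\mathfrak n$ that are skew-adjoint with respect to $\langle\cdot,\cdot\rangle$; for $A\in\mathfrak h$, $X\in\mathfrak n$ write $AX=[A,X]$. $M$ is $G$-geodesic orbit (GO) if every geodesic is an orbit of a one-parameter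 subgroup of $G$. By the Geodesic Lemma this is equivalent to: for every $T\in\mathfrak n$ there exist $A\in\mathfrak h$ and $k\in\mathbb R$ such that $\langle [T,T']+AT',\,T\rangle=k\langle T,T'\rangle$ for all $T'\in\mathfrak n$. A metric nilpotent Lie algebra $(\mathfrak m_0,\langle\cdot,\cdot\rangle_0)$ is called GO (corresponds to a GO nilmanifold) if this condition holds for it with $\mathfrak h$ replaced by the Lie algebra of all its skew-adjoint derivations. The index of a symmetric bilinear form is its number of negative squares; metric index three means signature $(n-3,3)$, $n=\dim N$. Orthogonal complements are taken in $\mathfrak n$. Double extension: for a totally isotropic $\mathfrak h$-invariant $F\subset\operatorname{rad}\mathfrak d$ with $[F,F^\perp]=0$ and $k=\dim F$, one has $\mathfrak d\subset F^\perp$, the ideal $F^\perp$ is a central extension of $\mathfrak m_0=F^\perp/F$ (with the induced bracket and induced nondegenerate metric) by $F$, and $\mathfrak n/F^\perp$ is abelian of dimension $k$, paired nondegenerately with $F$ by the metric. One then says that $\mathfrak n$ is a $2k$-dimensional double extension of $\mathfrak m_0$. *)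

(* Defs.v *)
From HB Require Import structures.
From mathcomp Require Import all_boot all_order all_algebra.
From mathcomp Require Import reals.

Set Implicit Arguments.
Unset Strict Implicit.
Unset Printing Implicit Defensive.

Import Order.TTheory GRing.Theory Num.Theory.
Local Open Scope ring_scope.

Record metricLieAlg (R : realType) := MetricLieAlg {
  carrier :> vectType R;
  lie : {bilinear carrier -> carrier -> carrier};
  ip : {symmetric carrier};
  liexx : forall x, lie x x = 0;
  lie_jacobi : forall x y z,
    lie x (lie y z) + lie y (lie z x) + lie z (lie x y) = 0;
  ip_nondegenerate : nondegenerate ip
}.

Arguments lie {R} m.
Arguments ip {R} m.

Section MetricLieAlgebra.
Variables (R : realType) (n : metricLieAlg R).
Implicit Types (U W F : {vspace n}) (A : 'End(n)).

Definition lie_span U W : {vspace n} :=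
  <<[seq lie n u w | u <- vbasis U, w <- vbasis W]>>%VS.

Lemma lie_spanP U W F :
  reflect {in U & W, forall u w, lie n u w \in F} (lie_span U W <= F)%VS.
Proof.
apply: (iffP span_subvP) => [sF u w uU wW|sF _ /allpairsP[[u w] [/= uU wW ->]]].
  rewrite (coord_vbasis uU) (coord_vbasis wW) linear_sumlz rpred_sum // => i _.
  rewrite linear_sumr rpred_sum // => j _.
  rewrite linearZlr /= !rpredZ // sF //.
  by apply: allpairs_f; apply: mem_nth; rewrite size_tuple.
by apply: sF; apply: vbasis_mem.
Qed.

Definition derived : {vspace n} := lie_span fullv fullv.

Fixpoint lower_central (k : nat) : {vspace n} :=
  if k is k'.+1 then lie_span fullv (lower_central k') else fullv.

Definition nilpotent_lie : Prop := exists k, lower_central k = 0%VS.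

Definition perp U : {vspace n} := orthov (ip n) U.

(* The restriction of the inner product to U is degenerate iff radical U != 0 *)
Definition radical U : {vspace n} := (U :&: perp U)%VS.

(* The number of negative squares in a diagonalisation; by Sylvester's law it
   does not depend on the orthogonal basis. As ip is nondegenerate, index q
   means signature (dim n - q, q). *)
Definition has_index (q : nat) : Prop :=
  exists2 e : seq n, basis_of fullv e && pairwise_orthogonal (ip n) e
    & count (fun v => ip n v v < 0) e = q.

Definition skew_derivation A : Prop :=
  (forall x y, A (lie n x y) = lie n (A x) y + lie n x (A y)) /\
  (forall x y, ip n (A x) y = - ip n x (A y)).

Definition skew_derivation_algebra (h : {vspace 'End(n)}) : Prop :=
  (forall A, A \in h -> skew_derivation A) /\
  (forall A B, A \in h -> B \in h -> (A \o B - B \o A)%VF \in h).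

(* The Lie-algebraic form of the geodesic orbit property given by the Geodesic
   Lemma; P is the set of derivations playing the role of Lie(H). *)
Definition geodesic_orbit (P : 'End(n) -> Prop) : Prop :=
  forall T : n, exists A, exists2 k : R, P A &
    forall T' : n, ip n (lie n T T' + A T') T = k * ip n T T'.

Definition GO_nilpotent : Prop :=
  nilpotent_lie /\ geodesic_orbit skew_derivation.

Definition h_invariant (h : {vspace 'End(n)}) F : Prop :=
  forall A, A \in h -> (A @: F <= F)%VS.

End MetricLieAlgebra.

(* n is a (2 dim F)-dimensional double extension of m, with m = F^perp / F:
   only the restriction of pi to F^perp matters, and it is the quotient map.
   (An arbitrary linear map on F^perp extends to n.) *)
Record double_extension (R : realType) (n m : metricLieAlg R)
    (h : {vspace 'End(n)}) (F : {vspace n}) (pi : 'Hom(n, m)) : Prop := {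
  dext_invariant : h_invariant h F;
  dext_isotropic : (F <= perp F)%VS;
  dext_rad : (F <= radical (derived n))%VS;
  dext_central : lie_span F (perp F) = 0%VS;
  dext_ideal : (lie_span fullv (perp F) <= perp F)%VS;
  dext_onto : (pi @: perp F)%VS = fullv;
  dext_ker : (lker pi :&: perp F)%VS = F;
  dext_lie :
    {in perp F &, forall x y, pi (lie n x y) = lie m (pi x) (pi y)};
  dext_ip : {in perp F &, forall x y, ip m (pi x) (pi y) = ip n x y};
  (* n / F^perp is abelian of dimension dim F and paired nondegenerately with
     F; nondegeneracy on the side of n / F^perp holds by definition of perp *)
  dext_abelian : (derived n <= perp F)%VS;
  dext_codim : \dim {:n} = (\dim (perp F) + \dim F)%N;
  dext_pairing : (F :&: perp fullv)%VS = 0%VS;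
  dext_dim : \dim {:n} = (\dim {:m} + 2 * \dim F)%N
}.

(* Main.v *)
(* Let U = rad d and let C_k be the lower central series (C_1 = d).  Take k
   maximal with F := U :&: C_k nonzero, so that U :&: C_{k+1} = 0; this F works.

   If P is h-invariant, the geodesic orbit condition makes ad p skew on perp P
   for every p in P.  Taking P = perp d shows that perp d normalises U, hence
   [F, perp d] lies in U :&: C_{k+1} = 0.  Once [F, d] = 0 is known as well, F
   commutes with perp U = d + perp d, and skewness of ad F on perp F puts
   [F, perp F] into U :&: C_{k+1} = 0.

   For [F, d] = 0, write I = C_{k+1} and E = perp I.  As I meets perp d only in
   0, E + d is everything, so E generates n.
   - If dim U > 1: ad x is skew on I for x in E, hence for all x.  A nonzero
     C_{k+4} would then give an isotropic subspace of I of dimension 2, which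
     together with U exceeds the index; so C_{k+4} = 0.  For u in F this makes
     [u, d] isotropic, hence at most a line, and a skew map of rank one is 0.
   - If U = <[u]>: Q = [u, E] is an h-invariant subspace of I of dimension at
     most 1; skewness of ad Q on perp Q, which contains E, gives [Q, E] <= Q,
     hence [Q, E] = 0 by nilpotency.  So Q is central, then [u, n] is central,
     and the Jacobi identity yields [u, [n, n]] = 0. *)

Require Import Defs.
From mathcomp Require Import all_boot all_order all_algebra.
From mathcomp Require Import reals.
From HB Require Import structures.
From mathcomp Require Import zify ring.

Set Implicit Arguments.
Unset Strict Implicit.
Unset Printing Implicit Defensive.

Import Order.TTheory GRing.Theory Num.Theory.
Local Open Scope ring_scope.

Lemma dim_le1_line (K : fieldType) (vT : vectType K) (W : {vspace vT}) w v :
  (\dim W <= 1)%N -> w \in W -> w != 0 -> v \in W -> exists a, v = a *: w.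
Proof.
move=> W1 wW w0 vW.
have WE : <[w]>%VS = W by apply/eqP; rewrite eqEdim -memvE wW dim_vline w0.
by move: vW; rewrite -WE => /vlineP.
Qed.

(** * Symmetric bilinear forms *)

Section OrthogonalComplement.
Variables (K : fieldType) (vT : vectType K) (f : {symmetric vT}).
Implicit Types (U W : {vspace vT}).

Lemma symC x y : f x y = f y x.
Proof. by rewrite hermC expr0 mul1r. Qed.

Lemma symDl x y z : f (x + y) z = f x z + f y z.
Proof. exact: linearDl. Qed.

Lemma symDr x y z : f z (x + y) = f z x + f z y.
Proof. exact: linearDr. Qed.

Lemma symBl x y z : f (x - y) z = f x z - f y z.
Proof. exact: linearBl. Qed.

Lemma symBr x y z : f z (x - y) = f z x - f z y.
Proof. exact: linearBr. Qed.

Lemma symZl a x z : f (a *: x) z = a * f x z.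
Proof. exact: linearZl_LR. Qed.

Lemma symZr a x z : f z (a *: x) = a * f z x.
Proof. exact: linearZr_LR. Qed.

Lemma sym_sumr (I : Type) (r : seq I) (F : I -> vT) z :
  f z (\sum_(i <- r) F i) = \sum_(i <- r) f z (F i).
Proof. exact: linear_sumr. Qed.

Lemma sym0l x : f 0 x = 0. Proof. exact: linear0l. Qed.

Lemma mem_orthov_addE U W x :
  (x \in orthov f (U + W)) = (x \in orthov f U) && (x \in orthov f W).
Proof. by rewrite !memvE orthovD. Qed.

(** Each vector of a spanning sequence lowers the dimension of the complement by at most one. *)
Lemma leq_dim_orthov U : (\dim {:vT} <= \dim (orthov f U) + \dim U)%N.
Proof.
have dimX X : (\dim {:vT} <= \dim (orthov f <<X>>) + size X)%N.
  elim: X => [|u X IH]; first by rewrite span_nil orthov0 addn0.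
  have ->: orthov f <<u :: X>> = (orthov f <<X>> :&: orthov f <[u]>)%VS.
    by apply/vspaceP => x; rewrite span_cons mem_orthov_addE memv_cap andbC.
  have := leq_dim_orthov1 f u (orthov f <<X>>); move: IH => /=.
  by case: (\dim (orthov f _)) => [|d] /=; lia.
by have := dimX (vbasis U); rewrite (span_basis (vbasisP U)) size_tuple.
Qed.

Hypothesis f_nondegenerate : nondegenerate f.

Lemma nondegenerateP x : (forall y, f x y = 0) -> x = 0.
Proof.
move=> fx0; apply/eqP; rewrite -memv0 -(eqP f_nondegenerate).
by apply/mem_orthovP => y _.
Qed.

Lemma dim_orthov U : (\dim (orthov f U) + \dim U)%N = \dim {:vT}.
Proof.
apply/eqP; rewrite eqn_leq leq_dim_orthov andbT.
(* A vector of [U] orthogonal to [X] is orthogonal to [orthov f U + X], the whole space, so it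
   vanishes. Hence [orthov f X], of dimension at least [\dim (orthov f U)], is disjoint from [U]. *)
pose X := ((orthov f U)^C)%VS.
have XU0 : (orthov f X :&: U = 0)%VS.
  apply/eqP; rewrite -subv0; apply/subvP => u; rewrite memv_cap memv0.
  case/andP => /mem_orthovP uX uU; apply/eqP/nondegenerateP => y.
  have : y \in (orthov f U + X)%VS by rewrite addv_complf memvf.
  case/memv_addP => a /mem_orthovP aU [b bX ->].
  by rewrite symDr (uX b bX) addr0 symC aU.
have := dimvS (subvf (orthov f X + U)%VS).
rewrite dimv_disjoint_sum //; have := leq_dim_orthov X; rewrite dimv_compl.
have := dimvS (subvf (orthov f U)); lia.
Qed.

Lemma orthovK U : orthov f (orthov f U) = U.
Proof.
have sUU : (U <= orthov f (orthov f U))%VS.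
  by apply/orthovP => u v uU /mem_orthovP vU; rewrite symC vU.
apply/esym/eqP; rewrite eqEdim sUU /=.
by have := dim_orthov U; have := dim_orthov (orthov f U); lia.
Qed.

Lemma orthovS U W : (U <= W)%VS -> (orthov f W <= orthov f U)%VS.
Proof.
move/subvP=> sUW; apply/orthovP => x y /mem_orthovP xW yU.
by apply: xW; apply: sUW.
Qed.

Lemma orthov_cap U W : orthov f (U :&: W) = (orthov f U + orthov f W)%VS.
Proof.
rewrite -[RHS]orthovK; congr orthov; apply/vspaceP => x.
by rewrite mem_orthov_addE !orthovK memv_cap.
Qed.

End OrthogonalComplement.

(** * Orthogonal bases and seminegative subspaces over an ordered field *)

Section RealForm.
Variables (K : realFieldType) (vT : vectType K) (f : {symmetric vT}).
Implicit Types (U W : {vspace vT}).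

Lemma alternating_skew U (g : vT -> vT -> K) :
    (forall x y z, g (x + y) z = g x z + g y z) ->
    (forall x y z, g z (x + y) = g z x + g z y) ->
    {in U, forall x, g x x = 0} -> {in U &, forall x y, g x y = - g y x}.
Proof.
move=> gDl gDr g0 x y xU yU; apply/eqP; rewrite -addr_eq0.
have := g0 _ (memvD xU yU).
by rewrite gDl !gDr !g0 // add0r addr0 => ->.
Qed.

Lemma pairwise_orthogonal_neq e : pairwise_orthogonal f e ->
  {in e &, forall x y, x != y -> f x y = 0}.
Proof.
case/andP=> _; elim: e => //= v e IH /andP[]; rewrite andbT => /allP ve oe x y.
rewrite !inE => /predU1P[->|xe] /predU1P[->|ye]; rewrite ?eqxx // => xy.
- by apply/eqP/ve.
- by rewrite symC; apply/eqP/ve.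
- exact: IH.
Qed.

(** Gram-Schmidt for a possibly degenerate form: if the form vanishes on [U], any basis serves;
    otherwise an anisotropic [v] splits off and the induction continues in its complement within
    [U]. *)
Lemma exists_orthogonal_basis U :
  exists2 e, basis_of U e & pairwise_orthogonal f e.
Proof.
have [d] := ubnP (\dim U); elim: d U => // d IH U dU.
have [/existsP[i fi]|] := boolP [exists i : 'I_(\dim U), exists j : 'I_(\dim U),
  f (vbasis U)`_i (vbasis U)`_j != 0]; last first.
  rewrite negb_exists => /forallP f0; exists (vbasis U); first exact: vbasisP.
  rewrite /pairwise_orthogonal; apply/andP; split.
    by apply/negP => /(free_not0 (basis_free (vbasisP U)))/eqP.
  have: {in tval (vbasis U) &, forall x y, f x y = 0}.
    move=> x y /(nthP 0)[i + <-] /(nthP 0)[j + <-]; rewrite size_tuple => li lj.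
    have := f0 (Ordinal li); rewrite negb_exists => /forallP/(_ (Ordinal lj)).
    by rewrite negbK => /eqP.
  elim: (tval (vbasis U)) => //= v e IHe fve.
  rewrite IHe => [|x y xe ye]; last by apply: fve; rewrite inE ?xe ?ye orbT.
  rewrite !andbT; apply/allP => y ye /=.
  by rewrite fve ?inE ?eqxx ?ye ?orbT.
have [v vU fv] : exists2 v, v \in U & f v v != 0.
  case/existsP: fi => j; set x := _`_i; set y := _`_j => fij.
  have [xU yU] : x \in U /\ y \in U.
    by split; apply: vbasis_mem; apply: mem_nth; rewrite size_tuple.
  have [fx|fx] := eqVneq (f x x) 0; last by exists x.
  have [fy|fy] := eqVneq (f y y) 0; last by exists y.
  (* With [x] and [y] both isotropic, the value at [x + y] is [2 * f x y], nonzero in characteristic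
     0. *)
  exists (x + y); first exact: memvD.
  rewrite symDl !symDr fx fy (symC f y) add0r addr0 -mulr2n -mulr_natl.
  by rewrite mulf_eq0 negb_or fij pnatr_eq0.
have vNU : v \notin orthov f U.
  by apply/mem_orthovPn; exists v.
have U_gt0 : (0 < \dim U)%N.
  rewrite lt0n dimv_eq0; apply: contraNneq fv => U0.
  by move: vU; rewrite U0 memv0 => /eqP->; rewrite sym0l.
have dimW := eq_dim_orthov1 vNU.
have [|e eb eo] := IH (U :&: orthov f <[v]>)%VS; first lia.
have Ue := span_basis eb.
exists (v :: e).
  rewrite basisEdim /= span_cons; apply/andP; split.
    apply/subvP => x xU; apply/memv_addP.
    exists ((f x v / f v v) *: v); first by rewrite memvZ // memv_line.
    exists (x - (f x v / f v v) *: v); last by rewrite addrC subrK.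
    rewrite Ue memv_cap memvB ?memvZ //= mem_orthov1 symC symBr symZr.
    by rewrite divfK // symC subrr.
  rewrite -(eqnP (basis_free eb)) Ue -dimW; lia.
case/andP: eo => e0 oe; apply/andP; split=> /=.
  rewrite inE negb_or e0 andbT eq_sym; apply: contraNneq fv => ->.
  by rewrite sym0l.
rewrite oe !andbT; apply/allP => x xe /=.
have : x \in (U :&: orthov f <[v]>)%VS by rewrite -Ue memv_span.
by rewrite memv_cap mem_orthov1 symC => /andP[].
Qed.

Lemma span_norm e x : {in e &, forall x y, x != y -> f x y = 0} ->
  uniq e -> x \in <<e>>%VS ->
  exists c : vT -> K, x = \sum_(v <- e) c v *: v /\
    f x x = \sum_(v <- e) c v ^+ 2 * f v v.
Proof.
elim: e x => [|v e IH] x oe /=.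
  rewrite span_nil memv0 => _ /eqP->; exists (fun=> 0).
  by rewrite !big_nil sym0l.
case/andP=> ve ue; rewrite span_cons => /memv_addP[_ /vlineP[a ->] [y ye ->]].
have oe' : {in e &, forall x y, x != y -> f x y = 0}.
  by move=> p q pe qe; apply: oe; rewrite inE ?pe ?qe orbT.
have [c [yE fy]] := IH y oe' ue ye.
(* As [v] does not recur in [e], changing the coefficient at [v] leaves the other terms intact. *)
exists (fun w => if w == v then a else c w); rewrite !big_cons eqxx.
have cE (T : nmodType) (F : K -> vT -> T) :
    \sum_(w <- e) F (if w == v then a else c w) w = \sum_(w <- e) F (c w) w.
  apply: eq_big_seq => w we; case: eqP => // wv; by rewrite -wv we in ve.
rewrite (cE _ (fun a w => a *: w)) (cE _ (fun a w => a ^+ 2 * f w w)) -yE -fy.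
split=> //; rewrite symDl !symDr symZl !symZr symZl.
have fvy : f v y = 0.
  rewrite yE sym_sumr big_seq big1 // => w we.
  rewrite symZr oe ?mulr0 ?mem_head ?inE ?we ?orbT //.
  by apply: contraNneq ve => ->.
by rewrite (symC f y v) fvy !mulr0 addr0 add0r; ring.
Qed.

Hypothesis f_nondegenerate : nondegenerate f.

(** An isotropic basis vector would be orthogonal to the whole basis, hence zero. *)
Lemma orthogonal_basis_anisotropic e : basis_of fullv e ->
  {in e &, forall x y, x != y -> f x y = 0} -> {in e, forall v, f v v != 0}.
Proof.
move=> eb eo v ve; apply: contraTneq (free_not0 (basis_free eb) ve) => fv.
rewrite negbK; apply/eqP/(nondegenerateP f_nondegenerate) => y.
have : y \in <<e>>%VS by rewrite (span_basis eb) memvf.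
case/(span_norm eo (free_uniq (basis_free eb))) => c [-> _].
rewrite sym_sumr big_seq big1 // => w we; rewrite symZr.
have [->|vw] := eqVneq w v; first by rewrite fv mulr0.
by rewrite eo ?mulr0 // eq_sym.
Qed.

(** The argument behind Sylvester's law: [W] meets the span of the positive basis vectors only in 0,
    and by anisotropy the remaining basis vectors are exactly the negative ones. *)
Lemma dim_seminegative e W : basis_of fullv e ->
    {in e &, forall x y, x != y -> f x y = 0} ->
  {in W, forall x, f x x <= 0} -> (\dim W <= count (fun v => (f v v < 0)%R) e)%N.
Proof.
move=> eb eo W0; pose p := [seq v <- e | 0 < f v v].
have pfree : free p by apply: filter_free; apply: basis_free eb.
have po : {in p &, forall x y, x != y -> f x y = 0}.
  by move=> x y; rewrite !mem_filter => /andP[_ xe] /andP[_ ye]; apply: eo.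
have Wp : (W :&: <<p>> = 0)%VS.
  apply/eqP; rewrite -subv0; apply/subvP => x /memv_capP[/W0 fx].
  case/(span_norm po (free_uniq pfree)) => c [xE fxE]; rewrite memv0 xE.
  rewrite big_seq big1 // => v vp.
  have t_ge0 w : w \in p -> 0 <= c w ^+ 2 * f w w.
    by rewrite mem_filter => /andP[fw _]; rewrite mulr_ge0 ?sqr_ge0 ?ltW.
  have : \sum_(w <- p) c w ^+ 2 * f w w == 0.
    rewrite eq_le -fxE fx fxE big_seq sumr_ge0 // => w; exact: t_ge0.
  rewrite big_seq psumr_eq0 // => /allP/(_ v vp); rewrite vp /=.
  rewrite mulf_eq0 sqrf_eq0 => /orP[/eqP->|]; first by rewrite scale0r.
  by move: vp; rewrite mem_filter => /andP[/lt0r_neq0/negPf->].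
have := dimvS (subvf (W + <<p>>)%VS).
rewrite dimv_disjoint_sum // (eqnP pfree) size_filter.
rewrite -(span_basis eb) (eqnP (basis_free eb)).
rewrite -(count_predC (fun v => (f v v < 0)%R) e).
have -> : count (predC (fun v => (f v v < 0)%R)) e = count (fun v => 0 < f v v) e.
  apply: eq_in_count => v ve /=.
  by rewrite -leNgt le_eqVlt eq_sym (negPf (orthogonal_basis_anisotropic eb eo ve)).
by rewrite leq_add2r.
Qed.

Lemma span_negative_le0 e x : {in e &, forall x y, x != y -> f x y = 0} ->
  uniq e -> {in e, forall v, f v v < 0} -> x \in <<e>>%VS -> f x x <= 0.
Proof.
move=> eo eu e0 /(span_norm eo eu)[c [_ ->]].
rewrite big_seq sumr_le0 // => v ve.
by rewrite mulr_ge0_le0 ?sqr_ge0 // ltW ?e0.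
Qed.

End RealForm.

(** * Brackets and nilpotency *)

Section MetricLieAlgebraTheory.
Variables (R : realType) (n : metricLieAlg R).
Implicit Types (U W F P : {vspace n}) (x y z : n).

Local Notation br := (lie n).
Local Notation C k := (lower_central n k).

Lemma ip_perp U x y : x \in perp U -> y \in U -> ip n x y = 0.
Proof. by move/mem_orthovP; apply. Qed.

Lemma dim_seminegative_index q W : has_index n q ->
  {in W, forall x, ip n x x <= 0} -> (\dim W <= q)%N.
Proof.
case=> e /andP[eb eo] <-; apply: dim_seminegative => //.
  exact: ip_nondegenerate.
exact: pairwise_orthogonal_neq.
Qed.

Lemma lieDl x y z : br (x + y) z = br x z + br y z.
Proof. exact: linearDl. Qed.

Lemma lieDr x y z : br z (x + y) = br z x + br z y.
Proof. exact: linearDr. Qed.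

Lemma lieBl x y z : br (x - y) z = br x z - br y z.
Proof. exact: linearBl. Qed.

Lemma lieBr x y z : br z (x - y) = br z x - br z y.
Proof. exact: linearBr. Qed.

Lemma lieZl a x z : br (a *: x) z = a *: br x z.
Proof. exact: linearZl_LR. Qed.

Lemma lieZr a x z : br z (a *: x) = a *: br z x.
Proof. exact: linearZr_LR. Qed.

Lemma lie0l x : br 0 x = 0. Proof. exact: linear0l. Qed.
Lemma lie0r x : br x 0 = 0. Proof. exact: linear0r. Qed.
Lemma lieNr x y : br x (- y) = - br x y. Proof. exact: linearNr. Qed.

Lemma lieC x y : br x y = - br y x.
Proof.
apply/eqP; rewrite -addr_eq0; have := liexx (x + y).
by rewrite lieDl !lieDr !liexx add0r addr0 => ->.
Qed.

Lemma lieA x y z : br x (br y z) = br (br x y) z + br y (br x z).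
Proof.
have /eqP := lie_jacobi x y z; rewrite -addrA addr_eq0 => /eqP->.
by rewrite (lieC z x) lieNr (lieC z (br x y)) opprD !opprK addrC.
Qed.

Lemma lie_span_ind U W (Q : n -> Prop) :
    Q 0 -> (forall a x y, Q x -> Q y -> Q (a *: x + y)) ->
    (forall x y, x \in U -> y \in W -> Q (br x y)) ->
  forall x, x \in lie_span U W -> Q x.
Proof.
move=> Q0 Qlin QUW x; rewrite /lie_span; set X := [seq _ | _ <- _, _ <- _].
have : forall y, y \in X -> Q y.
  by move=> y /allpairsP[[u w] [uU wW ->]]; apply: QUW; apply: vbasis_mem.
elim: X x => [|v X IH] x QX; first by rewrite span_nil memv0 => /eqP->.
rewrite span_cons => /memv_addP[_ /vlineP[a ->] [y yX ->]].
apply: Qlin; first by apply: QX; apply: mem_head.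
by apply: IH => // z zX; apply: QX; rewrite inE zX orbT.
Qed.

Lemma mem_lie_span U W x y : x \in U -> y \in W -> br x y \in lie_span U W.
Proof. by move: x y; apply/lie_spanP. Qed.

Lemma mem_lower_centralS k x y : y \in C k -> br x y \in C k.+1.
Proof. by apply: mem_lie_span; rewrite memvf. Qed.

Lemma mem_lower_centralSl k x y : x \in C k -> br x y \in C k.+1.
Proof. by move=> xk; rewrite lieC memvN; apply: mem_lower_centralS. Qed.

Lemma lower_centralS k : (C k.+1 <= C k)%VS.
Proof.
elim: k => [|k IH]; first exact: subvf.
apply/lie_spanP => x y _ yk; apply: mem_lower_centralS; exact: (subvP IH).
Qed.

Lemma lower_central_le j k : (j <= k)%N -> (C k <= C j)%VS.
Proof.
move/subnK<-; elim: (k - j)%N => [|i IH]; first by rewrite add0n.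
exact: subv_trans (lower_centralS _) IH.
Qed.

(** By Jacobi, a bracket with a commutator is a difference of two double brackets, so it descends
    two steps. *)
Lemma lie_derived_lower_central k x y :
  x \in derived n -> y \in C k -> br x y \in C k.+2.
Proof.
move=> xd yk; move: x xd; apply: lie_span_ind => [|a x x' xk x'k|x x' _ _].
- by rewrite lie0l mem0v.
- by rewrite lieDl lieZl memvD // memvZ.
have -> : br (br x x') y = br x (br x' y) - br x' (br x y).
  by rewrite (lieA x x' y) addrK.
by rewrite memvB //; do 2![apply: mem_lower_centralS].
Qed.

Section Nilpotent.
Hypothesis n_nilpotent : nilpotent_lie n.

Lemma lower_central_top U k0 : (U :&: C k0 != 0)%VS ->
  exists2 k, (k0 <= k)%N & (U :&: C k != 0)%VS /\ (U :&: C k.+1 = 0)%VS.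
Proof.
case: n_nilpotent => K CK U0.
have [//| |k /andP[kU k0k] kmax] :=
  @ex_maxnP (fun k => (U :&: C k != 0)%VS && (k0 <= k)%N) K.
- by exists k0; rewrite U0 leqnn.
- move=> i /andP[iU _]; rewrite leqNgt; apply: contra iU => /ltnW Ki.
  by rewrite -subv0 -CK (subv_trans (capvSr _ _)) // lower_central_le.
exists k => //; split=> //; apply: contraTeq (ltnSn k) => kU'.
by rewrite -leqNgt kmax // kU' ltnW.
Qed.

(** For [a != 0] the vector [y] is a multiple of [br x y], so it descends through the whole lower
    central series and is 0. *)
Lemma lie_eigen0 x y a : br x y = a *: y -> br x y = 0.
Proof.
have [->|a0] := eqVneq a 0; first by rewrite scale0r.
move=> xy; suff -> : y = 0 by rewrite lie0r.
case: n_nilpotent => K CK; apply/eqP; rewrite -memv0 -CK.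
elim: K {CK} => [|k IH]; first exact: memvf.
have -> : y = a^-1 *: br x y by rewrite xy scalerA mulVf // scale1r.
by rewrite memvZ // mem_lower_centralS.
Qed.

(** A nilpotent Lie algebra is generated by any subspace that spans it modulo the derived algebra;
    this is phrased as an induction principle for predicates closed under the Lie operations. Every
    vector is approximated modulo [C k], for growing [k], by one satisfying [Q]. *)
Lemma generation E (Q : n -> Prop) :
    (E + derived n)%VS = fullv -> Q 0 ->
    (forall a x y, Q x -> Q y -> Q (a *: x + y)) ->
    (forall x y, Q x -> Q y -> Q (br x y)) ->
    (forall x, x \in E -> Q x) -> forall x, Q x.
Proof.
move=> Ed Q0 Qlin Qlie QE x.
have QD y z : Q y -> Q z -> Q (y + z).
  by move=> Qy Qz; rewrite -[y]scale1r; apply: Qlin.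
suff QC k y : exists2 s, Q s & y - s \in C k.
  case: n_nilpotent => K CK; have [s Qs] := QC K x.
  by rewrite CK memv0 subr_eq0 => /eqP->.
elim: k y => [|k IH] y; first by exists 0 => //; apply: memvf.
have : y \in (E + derived n)%VS by rewrite Ed memvf.
case/memv_addP => e eE [d dd ->].
suff [s Qs ds] : exists2 s, Q s & d - s \in C k.+1.
  by exists (e + s); [apply: QD => //; apply: QE | rewrite opprD addrACA subrr add0r].
move: d dd; apply: lie_span_ind => [|a u v [s Qs us] [t Qt vt]|u v _ _].
- by exists 0 => //; rewrite subr0 mem0v.
- exists (a *: s + t); first exact: Qlin.
  by rewrite opprD addrACA -scalerBr memvD // memvZ.
have [s Qs us] := IH u; have [t Qt vt] := IH v.
exists (br s t); first exact: Qlie.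
(* Bracketing approximations modulo [C k] yields one modulo [C k.+1]: this gains the step. *)
have -> : br u v - br s t = br (u - s) v + br s (v - t).
  by rewrite lieBl lieBr addrA subrK.
apply: memvD; [exact: mem_lower_centralSl | exact: mem_lower_centralS].
Qed.

End Nilpotent.
End MetricLieAlgebraTheory.

(** * The geodesic orbit condition *)

Section GeodesicOrbit.
Variables (R : realType) (n : metricLieAlg R) (h : {vspace 'End(n)}).
Hypothesis h_alg : skew_derivation_algebra h.
Implicit Types (U W F P : {vspace n}) (x y z : n).

Local Notation br := (lie n).
Local Notation "<< x , y >>" := (ip n x y).
Local Notation C k := (lower_central n k).

Lemma h_invariantP U :
  h_invariant h U <-> (forall A, A \in h -> forall x, x \in U -> A x \in U).
Proof.
split=> Uh A Ah => [x xU|]; first by apply: (subvP (Uh A Ah)); apply: memv_img.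
by apply/subvP => _ /memv_imgP[x xU ->]; apply: Uh.
Qed.

Lemma h_invariant_lie_span U W :
  h_invariant h U -> h_invariant h W -> h_invariant h (lie_span U W).
Proof.
move=> /h_invariantP Uh /h_invariantP Wh; apply/h_invariantP => A Ah.
apply: lie_span_ind => [|a x y xA yA|x y xU yW].
- by rewrite linear0 mem0v.
- by rewrite linearP memvD // memvZ.
- by rewrite (h_alg.1 A Ah).1 memvD ?mem_lie_span ?Uh ?Wh.
Qed.

Lemma h_invariant_lower_central k : h_invariant h (C k).
Proof.
have fh : h_invariant h (fullv : {vspace n}) by move=> A _; apply: subvf.
by elim: k => //= k IH; apply: h_invariant_lie_span.
Qed.

Lemma h_invariant_perp U : h_invariant h U -> h_invariant h (perp U).
Proof.
move=> /h_invariantP Uh; apply/h_invariantP => A Ah x /mem_orthovP xU.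
by apply/mem_orthovP => y yU; rewrite (h_alg.1 A Ah).2 xU ?oppr0 ?Uh.
Qed.

Lemma h_invariant_cap U W :
  h_invariant h U -> h_invariant h W -> h_invariant h (U :&: W).
Proof.
move=> /h_invariantP Uh /h_invariantP Wh; apply/h_invariantP => A Ah x.
by rewrite !memv_cap => /andP[xU xW]; rewrite Uh ?Wh.
Qed.

Hypothesis n_GO : geodesic_orbit (fun A => A \in h).

(** In the geodesic condition at [T = x], [T' = p], both [A p] and [p] lie in [P] and are orthogonal
    to [x]; only the bracket term survives. *)
Lemma ip_lie_perp P p x : h_invariant h P -> p \in P -> x \in perp P ->
  << br p x, x >> = 0.
Proof.
move=> /h_invariantP Ph pP /mem_orthovP xP; have [A [k Ah /(_ p)]] := n_GO x.
rewrite symDl (symC (ip n) (A p)) !xP ?Ph // mulr0 addr0 lieC linearNl.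
by move/eqP; rewrite oppr_eq0 => /eqP.
Qed.

(** Polarisation of [ip_lie_perp]. All later skewness statements come from this one by a choice of
    [P]. *)
Lemma ad_skew_perp P p x y : h_invariant h P -> p \in P ->
  x \in perp P -> y \in perp P -> << br p x, y >> = - << x, br p y >>.
Proof.
move=> Ph pP xP yP; rewrite (symC (ip n) x).
apply: (alternating_skew (U := perp P) (g := fun u v => << br p u, v >>)) => //.
- by move=> u v w; rewrite lieDr symDl.
- by move=> u v w; rewrite symDr.
- by move=> u uP; apply: ip_lie_perp uP.
Qed.

Hypothesis n_nilpotent : nilpotent_lie n.
Local Notation d := (derived n).
Local Notation U := (radical d).

Lemma perp_radical : perp U = (d + perp d)%VS.
Proof.
rewrite /radical /perp orthov_cap ?ip_nondegenerate //.
by rewrite orthovK ?ip_nondegenerate // addvC.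
Qed.

Lemma h_invariant_radical : h_invariant h U.
Proof.
have dh := h_invariant_lower_central 1.
by apply: h_invariant_cap => //; apply: h_invariant_perp.
Qed.

Lemma lie_perp_derived_radical x u : x \in perp d -> u \in U -> br x u \in U.
Proof.
move=> xd; rewrite memv_cap => /andP[ud /mem_orthovP uU].
have [dh K] : h_invariant h d /\ perp (perp d) = d.
  by split; [exact: (h_invariant_lower_central 1) | apply/orthovK/ip_nondegenerate].
rewrite memv_cap mem_lie_span ?memvf //=; apply/mem_orthovP => y yd.
(* With [P = perp d], skewness holds on [perp (perp d)], which is [d]. *)
rewrite (ad_skew_perp (P := perp d)) ?K //; last exact: h_invariant_perp.
by rewrite uU ?oppr0 // mem_lie_span ?memvf.
Qed.

(** * The last nonzero intersection of the radical with the lower central series *)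

Section TopOfRadical.
Variable k : nat.
Hypothesis k_gt0 : (0 < k)%N.
Local Notation F := (U :&: C k)%VS.
Hypothesis top_radical : (U :&: C k.+1 = 0)%VS.
Local Notation I := (C k.+1).
Local Notation E := (perp I).

Lemma radical_cap_eq0 x : x \in U -> x \in I -> x = 0.
Proof. by move=> xU xI; apply/eqP; rewrite -memv0 -top_radical memv_cap xU. Qed.

Lemma sub_derived j : (0 < j)%N -> (C j <= d)%VS.
Proof. exact: (@lower_central_le _ n 1). Qed.

Lemma h_invariant_top : h_invariant h F.
Proof.
apply: h_invariant_cap; first exact: h_invariant_radical.
exact: h_invariant_lower_central.
Qed.

Lemma lie_top_perp_derived u x : u \in F -> x \in perp d -> br u x = 0.
Proof.
rewrite memv_cap => /andP[uU uk] xd; apply: radical_cap_eq0.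
  by rewrite lieC memvN lie_perp_derived_radical.
exact: mem_lower_centralSl.
Qed.

(** The complement of [E + d] is the part of [I] orthogonal to [d]; it lies in [U :&: I], which is
    0. *)
Lemma perp_add_derived : (E + d)%VS = fullv.
Proof.
have nd := ip_nondegenerate n.
rewrite -[(E + d)%VS](orthovK nd) -(orthov0 (ip n)); congr orthov.
apply/eqP; rewrite -subv0 -top_radical; apply/subvP => x.
rewrite mem_orthov_addE (orthovK nd) => /andP[xI xd].
by rewrite !memv_cap xd xI (subvP (sub_derived _) x xI).
Qed.

Lemma top_centralizes_perp : (forall u x, u \in F -> x \in d -> br u x = 0) ->
  lie_span F (perp F) = 0%VS.
Proof.
move=> Fd; have nd := ip_nondegenerate n.
have FU u x : u \in F -> x \in perp U -> br u x = 0.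
  rewrite perp_radical => uF /memv_addP[y yd [z zd ->]].
  by rewrite lieDr Fd // lie_top_perp_derived // addr0.
apply/eqP; rewrite -subv0; apply/lie_spanP => u x uF xF.
rewrite memv0; apply/eqP/radical_cap_eq0; last first.
  by move: uF; rewrite memv_cap => /andP[_]; apply: mem_lower_centralSl.
(* Membership in [U] is tested against [perp U], which lies in [perp F] and commutes with [F];
   skewness moves [br u] onto [y], where it vanishes. *)
rewrite -(orthovK nd U); apply/mem_orthovP => y yU.
have yF : y \in perp F by apply: subvP yU; apply/orthovS/capvSl.
by rewrite (ad_skew_perp h_invariant_top) // FU // linear0r oppr0.
Qed.

(** For [x] in [E] this is [ad_skew_perp] with [P = E], since [perp E = I]. As [I] is an ideal, the
    [x] acting on it by skew maps form a subalgebra, and [E] generates [n]. *)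
Lemma ad_skew_ideal x : {in I &, forall y z, << br x y, z >> = - << y, br x z >>}.
Proof.
move: x; apply: (generation n_nilpotent perp_add_derived).
- by move=> y z _ _; rewrite !lie0l sym0l linear0r oppr0.
- move=> a x x' xs x's y z yI zI.
  by rewrite !lieDl !lieZl symDl symDr symZl symZr xs ?x's // opprD mulrN.
- move=> x x' xs x's y z yI zI.
  have Jac w : br (br x x') w = br x (br x' w) - br x' (br x w).
    by rewrite (lieA x x' w) addrK.
  have II w v : v \in I -> br w v \in I.
    by move=> vI; apply: (subvP (lower_centralS n k.+1)); apply: mem_lower_centralS.
  rewrite !Jac symBr symBl (xs (br x' y) z) ?(x's y (br x z)) ?II //.
  by rewrite (x's (br x y) z) ?(xs y (br x' z)) ?II // !opprK opprB.
- move=> x xE y z yI zI.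
  have EK : perp E = I by apply/orthovK/ip_nondegenerate.
  apply: (@ad_skew_perp E) => //; rewrite ?EK //.
  exact/h_invariant_perp/h_invariant_lower_central.
Qed.

(** [U] is orthogonal to [d], which contains both [U] and [W]; the sum is direct because
    [U :&: I = 0]. This is how the index bounds subspaces of [I]. *)
Lemma radical_add_isotropic W : (W <= I)%VS -> {in W, forall x, << x, x >> = 0} ->
  {in (U + W)%VS, forall x, << x, x >> = 0} /\ \dim (U + W) = (\dim U + \dim W)%N.
Proof.
move=> WI W0; split; last first.
  apply: dimv_disjoint_sum; apply/eqP; rewrite -subv0 -top_radical.
  by apply: capvS.
move=> _ /memv_addP[u uU [w wW ->]].
have ud y : y \in d -> << u, y >> = 0.
  by apply/mem_orthovP; move: uU; rewrite memv_cap => /andP[].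
have dU : u \in d by move: uU; rewrite memv_cap => /andP[].
have wd : w \in d by apply/(subvP (@sub_derived k.+1 _))/(subvP WI).
by rewrite symDl !symDr (symC (ip n) w) !ud // W0 ?addr0.
Qed.

Lemma lower_central_vanish q : has_index n q -> (q < \dim U + 2)%N ->
  C k.+4 = 0%VS.
Proof.
move=> nq qU; apply/eqP; rewrite -[C _]capfv; apply: contraTT qU => C0.
have [s ks [Cs Cs']] := lower_central_top n_nilpotent C0.
(* The last nonzero term has number [s = t + 3] at least [k + 4], so [C t] already lies in [I] and
   skewness applies from there on. *)
case: s ks Cs Cs' => [|[|[|t]]] // kt; rewrite !capfv => Ct3 Ct4.
have tI j : (C (j + t) <= I)%VS.
  by apply: lower_central_le; apply: leq_trans (leq_addl j t).
(* Skewness trades a bracket on one side for a bracket on the other: first [C t.+1] is orthogonal to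
   [C t.+3] because [C t.+4 = 0], then [C t.+2] is orthogonal to itself. *)
have Ct13 : {in C t.+1 & C t.+3, forall x z, << x, z >> = 0}.
  move=> x z xt zt; move: x xt; apply: lie_span_ind => [|a x y xz yz|x y _ yt].
  - exact: sym0l.
  - by rewrite symDl symZl xz yz mulr0 addr0.
  - rewrite ad_skew_ideal ?(subvP (tI 0) y) ?(subvP (tI 3) z) //.
    have : br x z \in C t.+4 by apply: mem_lower_centralS.
    by rewrite Ct4 memv0 => /eqP->; rewrite linear0r oppr0.
have iso2 : {in C t.+2 &, forall x y, << x, y >> = 0}.
  move=> x y xt yt; move: x xt; apply: lie_span_ind => [|a v z vy zy|v z _ zt].
  - exact: sym0l.
  - by rewrite symDl symZl vy zy mulr0 addr0.
  - rewrite ad_skew_ideal; [|exact: (subvP (tI 1)) | exact: (subvP (tI 2))].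
    by rewrite Ct13 ?oppr0 // mem_lower_centralS.
have iso : {in C t.+2, forall x, << x, x >> = 0} by move=> x xt; apply: iso2.
have [iso3 dim3] := radical_add_isotropic (tI 2) iso.
(* [C t.+2] strictly contains the nonzero [C t.+3]; equality would force [C t.+4 = C t.+3]. *)
have dim_gt1 : (1 < \dim (C t.+2))%N.
  have Ct3_gt0 : (0 < \dim (C t.+3))%N by rewrite lt0n dimv_eq0.
  apply: leq_ltn_trans Ct3_gt0 _; rewrite ltn_neqAle dimvS ?lower_centralS // andbT.
  apply: contra Ct3 => eqd.
  have Ct32 : C t.+3 = C t.+2 by apply/eqP; rewrite eqEdim lower_centralS (eqP eqd) /=.
  by rewrite -Ct4 -[C t.+4]/(lie_span fullv (C t.+3)) {2}Ct32 eqxx.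
have := dim_seminegative_index nq (W := (U + C t.+2)%VS).
rewrite dim3 -leqNgt => le; apply: leq_trans (le _) => [|x xU].
  by rewrite leq_add2l.
by rewrite iso3.
Qed.

Lemma mem_top_lower_central u x : u \in F -> br u x \in I.
Proof. by rewrite memv_cap => /andP[_]; apply: mem_lower_centralSl. Qed.

Lemma skew_top u x y : u \in F -> x \in perp U -> y \in perp U ->
  << br u x, y >> = - << x, br u y >>.
Proof.
rewrite memv_cap => /andP[uU _]; apply: ad_skew_perp => //.
exact: h_invariant_radical.
Qed.

Lemma sub_derived_perp : (d <= perp U)%VS.
Proof. by rewrite perp_radical addvSl. Qed.

Lemma top_centralizes_derived_big : has_index n 3 -> (1 < \dim U)%N ->
  forall u x, u \in F -> x \in d -> br u x = 0.
Proof.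
move=> n3 U2 u x uF xd; have C4 : C k.+4 = 0%VS.
  by apply: (lower_central_vanish n3); lia.
pose B := (linfun (br u) @: d)%VS.
have memB y : y \in d -> br u y \in B.
  by move=> yd; apply/memv_imgP; exists y => //; rewrite lfunE.
have ud : u \in d by move: uF; rewrite !memv_cap => /andP[/andP[]].
have BI : (B <= I)%VS.
  apply/subvP => _ /memv_imgP[y _ ->]; rewrite lfunE.
  exact: mem_top_lower_central.
have dP := subvP sub_derived_perp.
have iso : {in B, forall y, << y, y >> = 0}.
  move=> _ /memv_imgP[y yd ->]; rewrite lfunE /=.
  (* Both [y] and [u] lie in [d], so the two brackets descend two steps each from [u] in [C k]. *)
  have uuy : br u (br u y) = 0.
    apply/eqP; rewrite -memv0 -C4; apply: lie_derived_lower_central => //.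
    rewrite lieC memvN; apply: lie_derived_lower_central => //.
    by move: uF; rewrite memv_cap => /andP[].
  rewrite skew_top ?uuy ?linear0r ?oppr0 // dP //.
  exact: mem_lie_span (memvf _) (memvf _).
have [iso3 dim3] := radical_add_isotropic BI iso.
have B1 : (\dim B <= 1)%N.
  have := dim_seminegative_index n3 (W := (U + B)%VS).
  rewrite dim3 => le; rewrite -(leq_add2l (\dim U)).
  apply: leq_trans (le _) _ => [y yU|]; first by rewrite iso3.
  by lia.
(* If [br u x] is nonzero it spans [B], and it suffices to show it orthogonal to [d]. For [y] in [d]
   write [br u y = a *: br u x]; skewness makes [br u y] orthogonal to [y]. So either [br u x] is
   orthogonal to [y], or [a = 0] and skewness again gives orthogonality. *)
have [//|ux0] := eqVneq (br u x) 0; case/eqP: (ux0).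
apply: radical_cap_eq0; last exact: mem_top_lower_central.
rewrite memv_cap mem_lie_span ?memvf //=; apply/mem_orthovP => y yd.
have [a uy] := dim_le1_line B1 (memB x xd) ux0 (memB y yd).
have /eqP := skew_top uF (dP y yd) (dP y yd).
rewrite (symC (ip n) y) -addr_eq0 -mulr2n -mulr_natl mulf_eq0 pnatr_eq0 /=.
rewrite uy symZl mulf_eq0 => /orP[/eqP a0|/eqP//].
by rewrite skew_top ?dP // uy a0 scale0r linear0r oppr0.
Qed.

Lemma top_centralizes_derived_line : \dim U = 1 ->
  forall u x, u \in F -> x \in d -> br u x = 0.
Proof.
move=> U1 u x uF xd.
have [->|u0] := eqVneq u 0; first by rewrite lie0l.
have uU : u \in U by move: uF; rewrite memv_cap => /andP[].
have Ul : U = <[u]>%VS.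
  by apply/esym/eqP; rewrite eqEdim -memvE uU dim_vline u0 U1.
have EK : perp E = I by apply/orthovK/ip_nondegenerate.
pose Q := (linfun (br u) @: E)%VS.
have QI : (Q <= I)%VS.
  apply/subvP => _ /memv_imgP[y _ ->]; rewrite lfunE.
  exact: mem_top_lower_central.
have Q1 : (\dim Q <= 1)%N.
  have := limg_ker_dim (linfun (br u)) E; rewrite -/Q.
  have := leq_dim_orthov1 (ip n) u E.
  (* The vectors of [E] orthogonal to [u] have codimension at most one in [E]; they are killed by
     [br u], so the image [Q] is at most a line. *)
  suff /dimvS : (E :&: orthov (ip n) <[u]> <= E :&: lker (linfun (br u)))%VS by lia.
  apply/subvP => y; rewrite -Ul !memv_cap memv_ker lfunE /= => /andP[yE yU].
  rewrite yE /=; apply/eqP/radical_cap_eq0; last exact: mem_top_lower_central.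
  rewrite -[U](orthovK (ip_nondegenerate n)); apply/mem_orthovP => z zU.
  rewrite skew_top // (ip_perp yE) ?oppr0 //.
  exact: mem_top_lower_central.
have Eh : h_invariant h E.
  exact/h_invariant_perp/h_invariant_lower_central.
have Qh : h_invariant h Q.
  apply/h_invariantP => A Ah _ /memv_imgP[e eE ->]; rewrite lfunE /=.
  rewrite (h_alg.1 A Ah).1.
  (* [U] is an invariant line, so [u] is an eigenvector of [A] and the Leibniz rule keeps
     [A (br u e)] in [Q]. *)
  have Au : A u \in U by apply: (h_invariantP U).1 Ah _ uU; apply: h_invariant_radical.
  move: Au; rewrite Ul => /vlineP[a ->]; rewrite lieZl memvD ?memvZ //.
    by apply/memv_imgP; exists e; rewrite ?lfunE.
  apply/memv_imgP; exists (A e); rewrite ?lfunE //.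
  exact: (h_invariantP E).1 Eh _ Ah _ eE.
have QE q e : q \in Q -> e \in E -> br e q = 0.
  move=> qQ eE; have qI := subvP QI q qQ.
  have EQ : (E <= perp Q)%VS by apply: orthovS.
  have eqQ : br e q \in Q.
    rewrite lieC memvN -[Q](orthovK (ip_nondegenerate n)).
    apply/mem_orthovP => z zQ; rewrite (ad_skew_perp Qh) ?(subvP EQ e) //.
    rewrite (ip_perp eE) ?oppr0 //.
    apply: (subvP (lower_centralS n k.+1)); exact: mem_lower_centralSl.
  have [->|q0] := eqVneq q 0; first by rewrite lie0r.
  have [a eq] := dim_le1_line Q1 qQ q0 eqQ.
  exact: lie_eigen0 n_nilpotent _ _ _ eq.
have Qc y : forall q, q \in Q -> br y q = 0.
  move: y; apply: (generation n_nilpotent perp_add_derived).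
  - by move=> q _; rewrite lie0l.
  - by move=> a y z yQ zQ q qQ; rewrite lieDl lieZl yQ ?zQ // scaler0 addr0.
  - move=> y z yQ zQ q qQ; have := lieA y z q.
    by rewrite (zQ q qQ) (yQ q qQ) !lie0r addr0 => <-.
  - by move=> y yE q qQ; apply: QE.
(* The [y] with [br u y] central form a subalgebra, since Jacobi gives [br u (br y y') = 0] for two
   of them; it contains [E]. *)
have uc y : forall z, br (br u y) z = 0.
  move: y; apply: (generation n_nilpotent perp_add_derived).
  - by move=> z; rewrite lie0r lie0l.
  - by move=> a y y' yz y'z z; rewrite lieDr lieZr lieDl lieZl yz y'z scaler0 addr0.
  - move=> y y' yz y'z z; rewrite lieA yz (lieC y) y'z oppr0 addr0.
    exact: lie0l.
  - move=> e eE z; rewrite lieC Qc ?oppr0 //.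
    by apply/memv_imgP; exists e; rewrite ?lfunE.
move: x xd; apply: lie_span_ind => [|a y z uy uz|y z _ _].
- exact: lie0r.
- by rewrite lieDr lieZr uy uz scaler0 addr0.
- by rewrite lieA uc (lieC y) uc oppr0 addr0.
Qed.

End TopOfRadical.

Lemma exists_central_isotropic : has_index n 3 -> U <> 0%VS ->
  exists F, [/\ F <> 0%VS, h_invariant h F, (F <= U)%VS & lie_span F (perp F) = 0%VS].
Proof.
move=> n3 /eqP U0.
(* The search starts at 1, where the intersection is all of [U]; [k >= 1] keeps [C k] and [C k.+1]
   inside [d]. *)
have [|k k0 [F0 top]] := @lower_central_top _ _ n_nilpotent U 1.
  by rewrite (capv_idPl _) // capvSl.
exists (U :&: C k)%VS; split; first exact/eqP.
- exact: h_invariant_top.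
- exact: capvSl.
apply: top_centralizes_perp => //.
have : (0 < \dim U)%N by rewrite lt0n dimv_eq0.
rewrite leq_eqVlt => /predU1P[/esym U1|U2].
- exact: top_centralizes_derived_line.
- exact: top_centralizes_derived_big.
Qed.

End GeodesicOrbit.

(** * The quotient of perp F by F *)

Section Quotient.
Variables (R : realType) (n : metricLieAlg R) (F : {vspace n}).
Hypothesis F_isotropic : (F <= perp F)%VS.
Hypothesis F_derived : (F <= perp (derived n))%VS.
Hypothesis F_central : lie_span F (perp F) = 0%VS.

(** The quotient is modelled on a linear complement of [F] in [perp F], so its elements are vectors
    of [n] and its metric is a plain restriction. *)
Definition quot_space : {vspace n} := (perp F :\: F)%VS.
Local Notation S := quot_space.
Local Notation m := (subvs_of S).

(** Projection along [F]; it represents the quotient map only on [perp F]. *)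
Definition quot_proj : 'Hom(n, m) := linfun (vsproj S \o daddv_pi S F).
Local Notation pi := quot_proj.

Lemma quot_capF : (S :&: F = 0)%VS.
Proof. exact: capv_diff. Qed.

Lemma quot_addF : (S + F = perp F)%VS.
Proof. by rewrite addv_diff; apply/addv_idPl. Qed.

Lemma vsval_quot_proj x : vsval (pi x) = daddv_pi S F x.
Proof. by rewrite lfunE /= vsprojK // memv_pi. Qed.

Lemma quot_projK (x : m) : pi (vsval x) = x.
Proof.
apply: subvs_inj; rewrite vsval_quot_proj daddv_pi_id ?quot_capF //.
exact: subvsP.
Qed.

Lemma subvs_perp (x : m) : vsval x \in perp F.
Proof. by rewrite -quot_addF (subvP (addvSl _ _)) // subvsP. Qed.

Lemma quot_proj_sub x : x \in perp F -> x - vsval (pi x) \in F.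
Proof.
rewrite -quot_addF => xF; rewrite vsval_quot_proj.
by rewrite -[X in X - _](daddv_pi_add quot_capF xF) addrC addKr memv_pi.
Qed.

Lemma quot_proj0 x : x \in F -> pi x = 0.
Proof.
move=> xF; apply: subvs_inj; rewrite vsval_quot_proj /=.
have := daddv_pi_add quot_capF (subvP (addvSr S F) x xF).
have FS0 : (F :&: S = 0)%VS by rewrite capvC quot_capF.
by rewrite (daddv_pi_id FS0 xF) => /(canRL (addrK _)) ->; rewrite subrr.
Qed.

Lemma lie_central0 x y : x \in F -> y \in perp F -> lie n x y = 0.
Proof. by move=> xF yF; apply/eqP; rewrite -memv0 -F_central mem_lie_span. Qed.

Lemma derived_perp : (derived n <= perp F)%VS.
Proof. by rewrite /perp orthov_sym. Qed.

Lemma lie_perpF x y : lie n x y \in perp F.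
Proof. by apply: (subvP derived_perp); apply: mem_lie_span (memvf _) (memvf _). Qed.

(** The two representatives differ by an element of [F], which commutes with [perp F]. *)
Lemma lie_quot_projr x y : x \in perp F -> y \in perp F ->
  lie n x (vsval (pi y)) = lie n x y.
Proof.
move=> xF yF; apply/esym/eqP; rewrite -subr_eq0 -lieBr lieC.
by rewrite lie_central0 ?oppr0 // quot_proj_sub.
Qed.

Lemma lie_quot_projl x y : x \in perp F -> y \in perp F ->
  lie n (vsval (pi x)) y = lie n x y.
Proof. by move=> xF yF; rewrite lieC lie_quot_projr // -lieC. Qed.

Lemma ip_quot_projl x y : x \in perp F -> y \in perp F ->
  ip n (vsval (pi x)) y = ip n x y.
Proof.
move=> xF yF; apply/esym/eqP; rewrite -subr_eq0 -symBl symC.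
by rewrite (ip_perp yF) // quot_proj_sub.
Qed.

Definition quot_lie (x y : m) : m := pi (lie n (vsval x) (vsval y)).
Definition quot_ip (x y : m) : R := ip n (vsval x) (vsval y).

Lemma quot_lie_bilinear : bilinear_for
  (GRing.Scale.Law.clone _ _ *:%R _) (GRing.Scale.Law.clone _ _ *:%R _) quot_lie.
Proof.
by split=> z a x y; rewrite /quot_lie ?linearPl ?linearPr linearP.
Qed.

HB.instance Definition _ := bilinear_isBilinear.Build R m m m _ _ quot_lie
  quot_lie_bilinear.

Lemma quot_ip_bilinear : bilinear_for
  (GRing.Scale.Law.clone _ _ *%R _) (GRing.Scale.Law.clone _ _ (idfun \; *%R) _) quot_ip.
Proof.
by split=> z a x y; rewrite /quot_ip linearP ?linearPl ?linearPr.
Qed.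

HB.instance Definition _ := bilinear_isBilinear.Build R m m R _ _ quot_ip
  quot_ip_bilinear.

Lemma quot_ip_sym x y : quot_ip x y = (-1) ^+ false * idfun (quot_ip y x).
Proof. by rewrite mul1r /quot_ip symC. Qed.

HB.instance Definition _ := isHermitianSesquilinear.Build R m false idfun quot_ip
  quot_ip_sym.

Lemma quot_liexx x : quot_lie x x = 0.
Proof. by rewrite /quot_lie liexx linear0. Qed.

Lemma quot_jacobi x y z : quot_lie x (quot_lie y z) + quot_lie y (quot_lie z x)
  + quot_lie z (quot_lie x y) = 0.
Proof.
rewrite /quot_lie !lie_quot_projr ?subvs_perp ?lie_perpF //.
by rewrite -!linearD lie_jacobi linear0.
Qed.

Lemma quot_nondegenerate : nondegenerate (quot_ip : {symmetric m}).
Proof.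
apply/eqP/eqP; rewrite -subv0; apply/subvP => x /mem_orthovP x0.
rewrite memv0; apply/eqP; rewrite -(quot_projK x); apply: quot_proj0.
(* A vector of the complement orthogonal to all representatives is orthogonal to [perp F], so it
   lies in [F] and projects to 0. *)
rewrite -[F](orthovK (ip_nondegenerate n)); apply/mem_orthovP => y yF.
rewrite symC -ip_quot_projl ?subvs_perp // symC.
by apply: (x0 (pi y)); apply: memvf.
Qed.

Definition quot_alg : metricLieAlg R :=
  MetricLieAlg quot_liexx quot_jacobi quot_nondegenerate.

Lemma quot_nilpotent : nilpotent_lie n -> nilpotent_lie quot_alg.
Proof.
move=> [K CK]; exists K.
have sub k : (lower_central quot_alg k <=
    (pi : 'Hom(n, quot_alg)) @: (lower_central n k :&: perp F))%VS.
  elim: k => [|k IH].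
    apply/subvP => x _; apply/memv_imgP; exists (vsval x); last by rewrite quot_projK.
    by rewrite memv_cap memvf subvs_perp.
  apply/lie_spanP => x w _ /(subvP IH)/memv_imgP[y]; rewrite memv_cap.
  move=> /andP[yk yF] ->; apply/memv_imgP; exists (lie n (vsval x) y).
    by rewrite memv_cap lie_perpF mem_lower_centralS.
  by rewrite /= /quot_lie lie_quot_projr ?subvs_perp.
apply/eqP; rewrite -subv0; apply: subv_trans (sub K) _.
by rewrite CK cap0v limg0.
Qed.

(** An element of [h] preserves [F] and [perp F], so it descends to a skew derivation of the
    quotient; the geodesic condition at a representative of [T] descends with the same [k]. *)
Lemma quot_geodesic_orbit (h : {vspace 'End(n)}) : skew_derivation_algebra h ->
  h_invariant h F -> geodesic_orbit (fun A => A \in h) ->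
  geodesic_orbit (@skew_derivation R quot_alg).
Proof.
move=> h_alg Fh n_GO T; have [A [k Ah AT]] := n_GO (vsval T).
have Fperp := h_invariant_perp h_alg Fh.
have Fh' := (h_invariantP h F).1 Fh.
have Fp' := (h_invariantP h (perp F)).1 Fperp.
have [Ader Askew] := h_alg.1 A Ah.
pose B : 'End(quot_alg) := (pi \o (A \o linfun vsval))%VF.
have BE (x : m) : B x = pi (A (vsval x)) by rewrite /B !comp_lfunE [linfun vsval x]lfunE.
have piA x : x \in perp F -> pi (A (vsval (pi x))) = pi (A x).
  move=> xF; apply/esym/eqP; rewrite -subr_eq0 -!linearB /=.
  by apply/eqP/quot_proj0/Fh' => //; apply: quot_proj_sub.
have AF (x : m) : A (vsval x) \in perp F by apply: Fp' => //; apply: subvs_perp.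
exists B, k; first split=> x y.
- rewrite !BE /= /quot_lie piA ?lie_perpF // Ader linearD /=.
  by rewrite lie_quot_projl ?lie_quot_projr ?subvs_perp ?AF.
- rewrite !BE /= /quot_ip ip_quot_projl ?subvs_perp ?AF // Askew.
  by rewrite symC [in RHS]symC ip_quot_projl ?subvs_perp ?AF.
move=> T'; rewrite BE /= /quot_lie /quot_ip -linearD /=.
by rewrite ip_quot_projl ?subvs_perp // ?AT // memvD ?lie_perpF ?AF.
Qed.

Lemma dim_quot : \dim {:quot_alg} = \dim S.
Proof. by rewrite dimvf. Qed.

Lemma dim_perpF : (\dim S + \dim F)%N = \dim (perp F).
Proof. by rewrite -dimv_disjoint_sum ?quot_capF // quot_addF. Qed.

Lemma quot_double_extension (h : {vspace 'End(n)}) : h_invariant h F ->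
  (F <= derived n)%VS ->
  double_extension h F (pi : 'Hom(n, quot_alg)).
Proof.
move=> Fh Fd; have nd := ip_nondegenerate n.
have dimF := dim_orthov nd F; have dimS := dim_perpF.
split=> //.
- by rewrite subv_cap Fd.
- by apply/lie_spanP => x y _ _; apply: lie_perpF.
- apply/vspaceP => x; rewrite memvf; apply/memv_imgP.
  by exists (vsval x); rewrite ?subvs_perp ?quot_projK.
- apply/vspaceP => x; rewrite memv_cap memv_ker; apply/andP/idP.
    case=> /eqP px xF; have := quot_proj_sub xF.
    by rewrite [pi x]px linear0 addr0.
  by move=> xF; rewrite (subvP F_isotropic) //; split=> //; apply/eqP/quot_proj0.
- move=> x y xF yF /=; rewrite /quot_lie lie_quot_projl ?subvs_perp //.
  by rewrite lie_quot_projr.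
- move=> x y xF yF /=; rewrite /quot_ip ip_quot_projl ?subvs_perp // symC.
  by rewrite ip_quot_projl // symC.
- exact: derived_perp.
- by rewrite /perp (eqP nd) capv0.
- by rewrite dim_quot /perp in dimS *; lia.
Qed.

(** Lifting the span of the negative basis vectors and adding the isotropic [F], which is orthogonal
    to it, gives a seminegative subspace of [n] of dimension [q' + \dim F]. *)
Lemma quot_index q : has_index n q -> exists2 q', has_index quot_alg q' &
  (q' + \dim F <= q)%N.
Proof.
move=> nq; have [e eb eo] := exists_orthogonal_basis (ip quot_alg) fullv.
exists (count (fun v => ip quot_alg v v < 0) e); first by exists e; rewrite ?eb.
pose p := [seq v <- e | ip quot_alg v v < 0].
have pfree : free p by apply: filter_free; apply: basis_free eb.
have po : {in p &, forall x y, x != y -> ip quot_alg x y = 0}.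
  move=> x y; rewrite !mem_filter => /andP[_ xe] /andP[_ ye].
  exact: (pairwise_orthogonal_neq eo).
have p0 : {in p, forall v, ip quot_alg v v < 0}.
  by move=> v; rewrite mem_filter => /andP[].
pose W : {vspace n} := (linfun vsval @: <<p>>)%VS.
have WS : (W <= S)%VS.
  by apply/subvP => _ /memv_imgP[x _ ->]; rewrite lfunE subvsP.
have dimW : \dim W = count (fun v => ip quot_alg v v < 0) e.
  rewrite limg_dim_eq; first by rewrite (eqnP pfree) size_filter.
  apply/eqP; rewrite -subv0; apply/subvP => x /memv_capP[_].
  by rewrite memv_ker lfunE memv0 => /eqP x0; apply/eqP/subvs_inj.
rewrite -dimW -dimv_disjoint_sum; last first.
  by apply/eqP; rewrite -subv0 -quot_capF capvS.
apply: dim_seminegative_index nq _ => _ /memv_addP[_ /memv_imgP[x xp ->] [y yF ->]].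
rewrite lfunE /= symDl !symDr (ip_perp (subvs_perp x) yF) symC.
rewrite (ip_perp (subvs_perp x) yF) (ip_perp (subvP F_isotropic y yF) yF) !addr0.
exact: (span_negative_le0 po (free_uniq pfree) p0 xp).
Qed.

End Quotient.

Theorem theorem7 (R : realType) (n : metricLieAlg R) (h : {vspace 'End(n)})
    (n_nilpotent : nilpotent_lie n)
    (h_alg : skew_derivation_algebra h)
    (n_GO : geodesic_orbit (fun A => A \in h))
    (n_index : has_index n 3)
    (d_degenerate : radical (derived n) <> 0%VS) :
  exists F : {vspace n},
    [/\ F <> 0%VS, h_invariant h F, (F <= radical (derived n))%VS
      & lie_span F (perp F) = 0%VS] /\
    exists (m : metricLieAlg R) (pi : 'Hom(n, m)) (q : nat),
      [/\ double_extension h F pi, has_index m q, (q < 3)%N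
        & GO_nilpotent m].
Proof.
have [F [F0 Fh FU FF]] :=
  exists_central_isotropic h_alg n_GO n_nilpotent n_index d_degenerate.
exists F; split=> //.
have [Fd Fd'] : (F <= derived n)%VS /\ (F <= perp (derived n))%VS.
  by apply/andP; rewrite -subv_cap.
have F_iso : (F <= perp F)%VS by apply: subv_trans Fd' _; apply: orthovS.
have [q mq qF] := quot_index F_iso Fd' FF n_index.
exists (quot_alg F_iso Fd' FF), (quot_proj F), q; split=> //.
- exact: quot_double_extension.
- by move/eqP: F0; rewrite -dimv_eq0 -lt0n; lia.
- split; first exact: quot_nilpotent.
  exact: quot_geodesic_orbit h_alg Fh n_GO.
Qed.
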